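(* Let $(f,r)$, with $f\colon A\to B$ and $r\colon B\to A$, be a Schreier split epimorphism in the category $\mathcal{M}$ of cancellative conjugation monoids, with kernel $k\colon X\to A$ and Schreier retraction $q\colon A\to X$, and write $b\cdot x=q(r(b)+k(x))$. Then a morphism $h\colon X\to B$ in $\mathcal{M}$ induces an internal groupoid in $\mathcal{M}$ if and only if the following conditions hold: $(C_1)$ $h(b\cdot x)+b=b+h(x)$ for all $x\in X$, $b\in B$; $(C_2)$ $h(y)\cdot x+y=y+x$ for all $x,y\in X$; $(C_3)$ $X$ is a group and $-\overline{x}=\overline{(-x)}$ for all $x\in X$.
   Context: A conjugation monoid $(M,+,0,\overline{(\;)})$ is a monoid (written additively but not assumed commutative) equipped with a unary operation $\overline{(\;)}\colon M\to M$ satisfying, for all $x,y$: $\overline{x}+x=x+\overline{x}$; $x+\overline{y}+y=y+\overline{y}+x$; $\overline{(x+y)}=\overline{y}+\overline{x}$. It is cancellative if its underlying monoid is (left and right) cancellative. The category $\mathcal{M}$ has cancellative conjugation monoids as objects and monoid homomorphisms preserving the conjugation as morphisms. ''$X$ is a group'' means that the underlying monoid of $X$ is a group. A Schreier split epimorphism in $\mathcal{M}$ is a pair of morphisms $f\colon A\to B$, $r\colon B\to A$ in $\mathcal{M}$ with $fr=1_B$ such that, $k\colon X\to A$ being the kernel of $f$, there exists a unique set-theoretical map $q\colon A\to X$ (the Schreier retraction) with $a=kq(a)+rf(a)$ for every $a\in A$; equivalently, there is a map $q$ with $a=kq(a)+rf(a)$ and $x=q(k(x)+r(b))$ for all $a\in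 A$, $x\in X$, $b\in B$. A morphism $h\colon X\to B$ in $\mathcal{M}$ is said to induce an internal groupoid if there is a morphism $\tilde{h}\colon A\to B$ in $\mathcal{M}$ with $\tilde{h}k=h$ and $\tilde{h}r=1_B$ such that the reflexive graph with object of arrows $A$, object of objects $B$, domain $f$, codomain $\tilde{h}$ and identities $r$ is an internal groupoid in $\mathcal{M}$. The latter means that it is an internal category, i.e. there is a morphism $m\colon A\times_B A\to A$ in $\mathcal{M}$, where $A\times_B A=\{(a,a')\mid f(a)=\tilde{h}(a')\}$, giving the composition $m(a,a')=a\circ a'$ and satisfying the usual domain/codomain compatibilities ($f m(a,a')=f(a')$, $\tilde{h}m(a,a')=\tilde{h}(a)$), the identity axioms ($m(a,rf(a))=a$, $m(r\tilde{h}(a'),a')=a'$) and associativity, and moreover there is a morphism $t\colon A\to A$ in $\mathcal{M}$ giving inverses for $m$ ($f t=\tilde{h}$, $\tilde{h}t=f$, $m(t(a),a)=rf(a)$, $m(a,t(a))=r\tilde{h}(a)$). *)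

(* Defs.v *)
From HB Require Import structures.
From mathcomp Require Import all_boot all_algebra.
From mathcomp Require Import boolp.

Set Implicit Arguments.
Unset Strict Implicit.
Unset Printing Implicit Defensive.

Import GRing.Theory.
Local Open Scope ring_scope.

(* Monoids written additively are not assumed commutative, which rules out    *)
(* nmodType; they are built on baseAddUMagmaType, which only provides + and   *)
(* 0, and no choice structure is required on the carrier.                     *)
HB.mixin Record BaseAddUMagma_isNcMonoid M of Algebra.BaseAddUMagma M := {
  addmA : associative (@Algebra.add M);
  add0m : left_id 0 (@Algebra.add M);
  addm0 : right_id 0 (@Algebra.add M)
}.

#[short(type="ncMonoidType")]
HB.structure Definition NcMonoid :=
  {M of BaseAddUMagma_isNcMonoid M & Algebra.BaseAddUMagma M}.

HB.mixin Record NcMonoid_hasConj M of NcMonoid M := {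
  conjm : M -> M;
  addNm_comm : forall x : M, conjm x + x = x + conjm x;
  addNm_swap : forall x y : M, x + conjm y + y = y + conjm y + x;
  conjmD : forall x y : M, conjm (x + y) = conjm y + conjm x
}.

#[short(type="conjMonoidType")]
HB.structure Definition ConjMonoid := {M of NcMonoid_hasConj M & NcMonoid M}.

HB.mixin Record ConjMonoid_isCancellative M of ConjMonoid M := {
  addmI : right_injective (@Algebra.add M);
  addIm : left_injective (@Algebra.add M)
}.

#[short(type="cancConjMonoidType")]
HB.structure Definition CancConjMonoid :=
  {M of ConjMonoid_isCancellative M & ConjMonoid M}.

HB.mixin Record isConjMorphism (M N : conjMonoidType) (f : M -> N) := {
  cmorph_conj : {morph f : x / conjm x}
}.

HB.structure Definition ConjMorphism (M N : conjMonoidType) :=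
  {f of isConjMorphism M N f & GRing.Additive M f}.

Notation "{ 'conjmon' M -> N }" := (ConjMorphism.type M%type N%type)
  (at level 0, M at level 98, N at level 99,
   format "{ 'conjmon'  M  ->  N }") : type_scope.

(* The pullback A x_B A of c along d, as an object of the category of         *)
(* cancellative conjugation monoids: pairs (a, a') with d a = c a'.           *)
Section Pullback.
Variables (A B : cancConjMonoidType) (d c : {conjmon A -> B}).

Record pullback := Pullback {
  pb1 : A;
  pb2 : A;
  pbP : d pb1 = c pb2
}.

Lemma pullback_eq (p p' : pullback) :
  pb1 p = pb1 p' -> pb2 p = pb2 p' -> p = p'.
Proof.
case: p p' => [a1 a2 e] [b1 b2 e'] /= eq1 eq2.
by move: e'; rewrite -eq1 -eq2 => e'; rewrite (Prop_irrelevance e e').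
Qed.

Fact pb_zero_subproof : d 0 = c 0.
Proof. by rewrite !raddf0. Qed.

Fact pb_add_subproof (p p' : pullback) :
  d (pb1 p + pb1 p') = c (pb2 p + pb2 p').
Proof. by rewrite !raddfD /= !pbP. Qed.

Fact pb_conj_subproof (p : pullback) : d (conjm (pb1 p)) = c (conjm (pb2 p)).
Proof. by rewrite !cmorph_conj pbP. Qed.

Definition pb_zero := Pullback pb_zero_subproof.
Definition pb_add p p' := Pullback (pb_add_subproof p p').
Definition pb_conj p := Pullback (pb_conj_subproof p).

HB.instance Definition _ := Algebra.hasAdd.Build pullback pb_add.
HB.instance Definition _ := Algebra.hasZero.Build pullback pb_zero.

Fact pb_addA : associative pb_add.
Proof. by move=> p p' p''; apply: pullback_eq; rewrite /= addmA. Qed.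
Fact pb_add0 : left_id pb_zero pb_add.
Proof. by move=> p; apply: pullback_eq; rewrite /= add0m. Qed.
Fact pb_addr0 : right_id pb_zero pb_add.
Proof. by move=> p; apply: pullback_eq; rewrite /= addm0. Qed.
HB.instance Definition _ :=
  BaseAddUMagma_isNcMonoid.Build pullback pb_addA pb_add0 pb_addr0.

Fact pb_conj_comm p : pb_add (pb_conj p) p = pb_add p (pb_conj p).
Proof. by apply: pullback_eq; rewrite /= addNm_comm. Qed.
Fact pb_conj_swap p p' :
  pb_add (pb_add p (pb_conj p')) p' = pb_add (pb_add p' (pb_conj p')) p.
Proof. by apply: pullback_eq; rewrite /= addNm_swap. Qed.
Fact pb_conjD p p' : pb_conj (pb_add p p') = pb_add (pb_conj p') (pb_conj p).
Proof. by apply: pullback_eq; rewrite /= conjmD. Qed.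
HB.instance Definition _ :=
  NcMonoid_hasConj.Build pullback pb_conj_comm pb_conj_swap pb_conjD.

Fact pb_addI : right_injective pb_add.
Proof.
by move=> p p1 p2 [] /addmI e1 /addmI e2; apply: pullback_eq.
Qed.
Fact pb_addIr : left_injective pb_add.
Proof.
by move=> p p1 p2 [] /addIm e1 /addIm e2; apply: pullback_eq.
Qed.
HB.instance Definition _ :=
  ConjMonoid_isCancellative.Build pullback pb_addI pb_addIr.

End Pullback.

(* The kernel of f, by its universal property in the category.               *)
Definition is_kernel (X A B : cancConjMonoidType)
    (k : {conjmon X -> A}) (f : {conjmon A -> B}) : Prop :=
  (forall x, f (k x) = 0) /\
  (forall (Y : cancConjMonoidType) (g : {conjmon Y -> A}),
     (forall y, f (g y) = 0) ->
     exists g' : {conjmon Y -> X},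
       (forall y, k (g' y) = g y) /\
       (forall g'' : {conjmon Y -> X},
          (forall y, k (g'' y) = g y) -> g'' =1 g')).

Definition schreier_retraction (X A B : cancConjMonoidType)
    (f : {conjmon A -> B}) (r : {conjmon B -> A}) (k : {conjmon X -> A})
    (q : A -> X) : Prop :=
  forall a, a = k (q a) + r (f a).

Definition schreier_split_epi (X A B : cancConjMonoidType)
    (f : {conjmon A -> B}) (r : {conjmon B -> A}) (k : {conjmon X -> A}) :
    Prop :=
  [/\ forall b, f (r b) = b,
      is_kernel k f
    & exists q : A -> X, schreier_retraction f r k q /\
        (forall q' : A -> X, schreier_retraction f r k q' -> q' =1 q)].

Section InternalGroupoid.
(* d = domain, c = codomain, i = identities.                                 *)
Variables (A B : cancConjMonoidType).
Variables (d c : {conjmon A -> B}) (i : {conjmon B -> A}).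

Definition reflexive_graph : Prop :=
  (forall b, d (i b) = b) /\ (forall b, c (i b) = b).

(* Composability proofs are universally quantified; in a reflexive graph they *)
(* exist for the identity laws, and they exist for associativity by the       *)
(* (co)domain laws.                                                           *)
Definition internal_composition (m : {conjmon pullback d c -> A}) : Prop :=
  [/\ forall p, d (m p) = d (pb2 p) /\ c (m p) = c (pb1 p),
      forall a (e : d a = c (i (d a))), m (Pullback e) = a,
      forall a (e : d (i (c a)) = c a), m (Pullback e) = a
    & forall a a' a'' (e : d a = c a') (e' : d a' = c a'')
        (el : d (m (Pullback e)) = c a'') (er : d a = c (m (Pullback e'))),
        m (Pullback el) = m (Pullback er)].

Definition internal_inverse (m : {conjmon pullback d c -> A})
    (t : {conjmon A -> A}) : Prop :=
  [/\ forall a, d (t a) = c a /\ c (t a) = d a,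
      forall a (e : d (t a) = c a), m (Pullback e) = i (d a)
    & forall a (e : d a = c (t a)), m (Pullback e) = i (c a)].

Definition internal_groupoid : Prop :=
  reflexive_graph /\
  exists m : {conjmon pullback d c -> A},
    internal_composition m /\
    exists t : {conjmon A -> A}, internal_inverse m t.

End InternalGroupoid.

Definition induces_internal_groupoid (X A B : cancConjMonoidType)
    (f : {conjmon A -> B}) (r : {conjmon B -> A}) (k : {conjmon X -> A})
    (h : {conjmon X -> B}) : Prop :=
  exists ht : {conjmon A -> B},
    [/\ forall x, ht (k x) = h x,
        forall b, ht (r b) = b
      & internal_groupoid f ht r].

Definition schreier_action (X A B : cancConjMonoidType)
    (r : {conjmon B -> A}) (k : {conjmon X -> A}) (q : A -> X)
    (b : B) (x : X) : X :=
  q (r b + k x).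

(* opp is an inversion making the underlying monoid of X a group; it is       *)
(* unique when it exists.                                                     *)
Definition group_inversion (X : ncMonoidType) (opp : X -> X) : Prop :=
  left_inverse 0 opp (@Algebra.add X) /\ right_inverse 0 opp (@Algebra.add X).

(* Main.v *)
Require Import Defs.
From HB Require Import structures.
From mathcomp Require Import all_boot all_algebra.
From mathcomp Require Import boolp.

Set Implicit Arguments.
Unset Strict Implicit.
Unset Printing Implicit Defensive.

Import GRing.Theory.
Local Open Scope ring_scope.

(** Uniqueness of the Schreier retraction makes each arrow [a] decompose
uniquely as [k x + r b], with [x = q a] and [b = f a]; so [A] is [X * B] with
the addition of a semidirect product for the action [b . x], where
[r b + k x = k (b . x) + r b] ([action_swap], [retractionD]).

This leaves no choice for the groupoid structure.  The codomain map must be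
[a |-> h (q a) + f a].  A composable pair [(a, a')] is the sum of
[(k (q a), 0)] and [(r (f a), a')], two pairs whose composites the identity
laws prescribe, so that the composite of [(a, a')] must be [k (q a) + a']
([composition_unique]).  From there each condition expresses one part of the
structure:
- (C1) says that the codomain map is additive: apply it to [action_swap];
- (C2) says that composition is additive: it is the interchange law
  [(r (h y), k y) + (k x, 0)] in the forward direction, and conversely it
  extends from the arrows [k y] to all arrows in the form
  [k (c a . x) + a = a + k x], with [c] the codomain ([codomain_swap]);
- (C3) says that arrows are invertible: an inverse of [k x] has as its
  [X]-component a left opposite of [x], and conversely
  [k (- q a) + r (c a)] is inverse to [a].  Opposites commute with
  conjugation because the latter reverses sums and fixes [0]
  ([group_inversion_conj]).

Additivity of the inversion is not computed: an inverse of [a] is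
characterised by its domain and by its composite with [a], and sums and
conjugates of inverses satisfy the characterisation because composition is a
morphism ([left_inverse_unique]). *)

(** * Conjugation monoids and their morphisms *)

Lemma conjm0 (M : cancConjMonoidType) : conjm (0 : M) = 0.
Proof. by apply: (@addmI M (conjm 0)); rewrite -conjmD !addm0. Qed.

(** Cancellation in the target makes preservation of [0] automatic. *)
Lemma conjmon_of (M N : cancConjMonoidType) (g : M -> N) :
    {morph g : x y / x + y} -> {morph g : x / conjm x} ->
  exists g' : {conjmon M -> N}, g' =1 g.
Proof.
move=> gD gN.
have g0 : g 0 = 0 by apply: (@addmI N (g 0)); rewrite -gD !addm0.
exists (HB.pack_for {conjmon M -> N} g
  (Algebra.isNmodMorphism.Build M N g (conj g0 gD))
  (isConjMorphism.Build M N g gN)).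
by [].
Qed.

(** As conjugation reverses sums and fixes [0], it sends an opposite of [x] to
an opposite of [conjm x], and opposites are unique. *)
Lemma group_inversion_conj (M : cancConjMonoidType) (opp : M -> M) :
  group_inversion opp -> forall x, opp (conjm x) = conjm (opp x).
Proof.
move=> [oppl oppr] x; apply: (@addIm M (conjm x)).
by rewrite oppl -conjmD oppr conjm0.
Qed.

Lemma left_inverse_group (M : cancConjMonoidType) (opp : M -> M) :
  left_inverse 0 opp (@Algebra.add M) -> group_inversion opp.
Proof.
move=> oppl; split=> // x; apply: (@addmI M (opp x)).
by rewrite addmA oppl add0m addm0.
Qed.

(** * Schreier split epimorphisms as semidirect products *)

Section SchreierSplitEpi.
Variables (X A B : cancConjMonoidType).
Variables (f : {conjmon A -> B}) (r : {conjmon B -> A}).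
Variables (k : {conjmon X -> A}) (q : A -> X).
Hypothesis hfr : schreier_split_epi f r k.
Hypothesis hq : schreier_retraction f r k q.

Local Notation act := (schreier_action r k q).

Lemma splitK b : f (r b) = b. Proof. by case: hfr. Qed.

Lemma split_ker x : f (k x) = 0. Proof. by case: hfr => _ []. Qed.

(** If [k x + r b] had another component than [x], changing the retraction at
this single point would give a second retraction. *)
Lemma retractionE x b : q (k x + r b) = x.
Proof.
case: hfr => _ _ [q0 [_ q0_uniq]].
pose q' a := if asbool (a = k x + r b) then x else q a.
have hq' : schreier_retraction f r k q'.
  move=> a; rewrite /q'; case: asboolP => [->|_]; last exact: hq.
  by rewrite raddfD /= split_ker add0m splitK.
by rewrite (q0_uniq _ hq) -(q0_uniq _ hq') /q'; case: asboolP.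
Qed.

Lemma retraction_ker x : q (k x) = x.
Proof. by rewrite -[RHS](retractionE x 0) raddf0 addm0. Qed.

Lemma ker_inj : injective k.
Proof. exact: can_inj retraction_ker. Qed.

Lemma retraction_section b : q (r b) = 0.
Proof. by rewrite -[RHS](retractionE 0 b) raddf0 add0m. Qed.

Lemma action_swap b x : r b + k x = k (act b x) + r b.
Proof. by rewrite [LHS]hq raddfD /= splitK split_ker addm0. Qed.

Lemma actionD b b' x : act (b + b') x = act b (act b' x).
Proof.
apply: ker_inj; apply: (@addIm A (r (b + b'))); rewrite -action_swap.
by rewrite raddfD /= -addmA action_swap addmA action_swap addmA.
Qed.

Lemma retractionD a a' : q (a + a') = q a + act (f a) (q a').
Proof.
rewrite -[RHS](retractionE _ (f a + f a')) !raddfD /=; congr q.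
by rewrite {1}(hq a) {1}(hq a') addmA -(addmA (k _)) action_swap !addmA.
Qed.

Lemma retraction_kerD x a : q (k x + a) = x + q a.
Proof.
rewrite retractionD retraction_ker split_ker /schreier_action raddf0 add0m.
by rewrite retraction_ker.
Qed.

Lemma retraction_conj a : q (conjm a) = act (conjm (f a)) (conjm (q a)).
Proof.
rewrite -[RHS](retractionE _ (conjm (f a))) -action_swap; congr q.
by rewrite {1}(hq a) conjmD !cmorph_conj.
Qed.

(** * The conditions are necessary *)

Section Necessity.
Variable c : {conjmon A -> B}.
Hypothesis cr : forall b, c (r b) = b.

Lemma codomain_action b x : c (k (act b x)) + b = b + c (k x).
Proof. by have := congr1 c (action_swap b x); rewrite !raddfD /= !cr. Qed.

Variable m : {conjmon pullback f c -> A}.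
Hypothesis hm : internal_composition r m.

(** The pair [(a, a')] is the sum of [(k (q a), 0)], where [0] is the identity
at the domain of [k (q a)], and of [(r (f a), a')], where [r (f a)] is the
identity at the codomain of [a']. *)
Lemma composition_unique (p : pullback f c) : m p = k (q (pb1 p)) + pb2 p.
Proof.
case: hm => _ idr idl _; case: p => a a' e /=.
have e1 : f (k (q a)) = c 0 by rewrite split_ker raddf0.
have e2 : f (r (f a)) = c a' by rewrite splitK.
have -> : Pullback e = Pullback e1 + Pullback e2.
  by apply: pullback_eq; rewrite /= ?add0m // -hq.
rewrite raddfD /=; congr (_ + _).
  have e0 : r (f (k (q a))) = 0 by rewrite split_ker raddf0.
  by move: (idr (k (q a))); rewrite e0 => /(_ e1).
by move: e2; rewrite e => e2; apply: idl.
Qed.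

(** The two evaluations of the composite of [(r (c (k y)) + k x, k y)]: by the
general formula, and as the sum of [(r (c (k y)), k y)] and [(k x, 0)]. *)
Lemma composition_interchange x y : act (c (k y)) x + y = y + x.
Proof.
have e1 : f (r (c (k y))) = c (k y) by rewrite splitK.
have e2 : f (k x) = c 0 by rewrite split_ker raddf0.
have /= := raddfD m (Pullback e1) (Pullback e2).
rewrite !composition_unique /= !addm0 retraction_section raddf0 add0m.
by rewrite retraction_ker -!raddfD => /ker_inj.
Qed.

Lemma inverse_left_inverse (t : {conjmon A -> A}) :
    internal_inverse r m t ->
  left_inverse 0 (fun x => q (t (k x))) (@Algebra.add X).
Proof.
move=> [tdc tl _] x; apply: ker_inj.
have e : f (t (k x)) = c (k x) by case: (tdc (k x)).
have := tl _ e; rewrite composition_unique /= split_ker !raddf0.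
by rewrite raddfD.
Qed.

End Necessity.

(** * The conditions are sufficient *)

Section Sufficiency.
Variable h : {conjmon X -> B}.
Hypothesis C1 : forall x b, h (act b x) + b = b + h x.

Lemma codomain_exists :
  exists c : {conjmon A -> B}, forall a, c a = h (q a) + f a.
Proof.
apply: conjmon_of => [a a'|a].
  by rewrite retractionD !raddfD /= -!addmA (addmA (h (act _ _))) C1 !addmA.
by rewrite retraction_conj cmorph_conj C1 cmorph_conj conjmD.
Qed.

Hypothesis C2 : forall x y, act (h y) x + y = y + x.

Variable c : {conjmon A -> B}.
Hypothesis cE : forall a, c a = h (q a) + f a.

Lemma codomain_ker x : c (k x) = h x.
Proof. by rewrite cE retraction_ker split_ker addm0. Qed.

Lemma codomain_section b : c (r b) = b.
Proof. by rewrite cE retraction_section splitK raddf0 add0m. Qed.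

(** Condition (C2) is the case of the arrows [k y], and [action_swap] the case
of the identities [r b]; the general case combines them along the
decomposition of [a]. *)
Lemma codomain_swap a x : k (act (c a) x) + a = a + k x.
Proof.
rewrite cE actionD {3}(hq a) addmA -raddfD C2.
by rewrite raddfD /= -addmA -action_swap addmA -hq.
Qed.

(** A summand from [X] in the second pair has to move past the second arrow
[a1'] of the first pair.  It is acted on by the domain of [a1], which
composability identifies with the codomain of [a1'], so [codomain_swap]
applies; likewise for conjugates, which reverse sums. *)
Lemma composition_exists :
  exists m : {conjmon pullback f c -> A},
    forall p, m p = k (q (pb1 p)) + pb2 p.
Proof.
apply: conjmon_of => [[a1 a1' e1] [a2 a2' e2]|[a a' e]] /=.
  rewrite retractionD e1 raddfD /= -!addmA; congr (_ + _).
  by rewrite !addmA codomain_swap.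
by rewrite retraction_conj e -cmorph_conj codomain_swap conjmD cmorph_conj.
Qed.

Variable m : {conjmon pullback f c -> A}.
Hypothesis mE : forall p, m p = k (q (pb1 p)) + pb2 p.

Lemma composition_internal : internal_composition r m.
Proof.
split=> [[a a' e]|a e|a e|a a' a'' e e' el er]; rewrite !mE /=.
- by rewrite !raddfD /= split_ker add0m codomain_ker -e cE.
- by rewrite -hq.
- by rewrite retraction_section raddf0 add0m.
- by rewrite !mE /= !mE /= retraction_kerD raddfD addmA.
Qed.

(** The [X]-component of [u] is determined by its composite with [a], and its
[B]-component is its domain. *)
Lemma left_inverse_unique a u v :
    f u = f v -> k (q u) + a = k (q v) + a -> u = v.
Proof. by move=> fuv /addIm quv; rewrite (hq u) (hq v) fuv quv. Qed.

Variable opp : X -> X.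
Hypothesis hopp : group_inversion opp.

Lemma inverse_exists :
  exists t : {conjmon A -> A}, internal_inverse r m t.
Proof.
have [oppl oppr] := hopp.
pose s a := k (opp (q a)) + r (c a).
have fs a : f (s a) = c a by rewrite raddfD /= split_ker add0m splitK.
have qs a : q (s a) = opp (q a) by apply: retractionE.
have sl a : k (q (s a)) + a = r (f a).
  by rewrite qs {2}(hq a) addmA -(raddfD k) oppl raddf0 add0m.
have ml a : m (Pullback (fs a)) = r (f a) by rewrite mE /= sl.
(* The composites of [s a + s a'] with [a + a'] and of [conjm (s a)] with
   [conjm a] are computed through [m], which is a morphism. *)
have [|a|t tE] := @conjmon_of A A s.
- move=> a a'; apply: (@left_inverse_unique (a + a')).
    by rewrite fs (raddfD c) (raddfD f) /= !fs.
  have /= := mE (Pullback (fs a) + Pullback (fs a')).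
  by rewrite sl (raddfD m) /= !ml => <-; rewrite !raddfD.
- apply: (@left_inverse_unique (conjm a)).
    by rewrite fs !cmorph_conj fs.
  have /= := mE (conjm (Pullback (fs a))).
  by rewrite sl !cmorph_conj /= ml => <-.
exists t; split=> [a|a e|a e]; rewrite ?mE /= tE ?sl ?fs //.
  split=> //; rewrite cE qs fs cE addmA -(raddfD h) oppl.
  by rewrite raddf0 add0m.
by rewrite /s addmA -(raddfD k) oppr raddf0 add0m.
Qed.

End Sufficiency.

End SchreierSplitEpi.

(** * Characterisation of internal groupoids *)

Theorem proposition6p4 (X A B : cancConjMonoidType)
    (f : {conjmon A -> B}) (r : {conjmon B -> A})
    (k : {conjmon X -> A}) (q : A -> X)
    (hfr : schreier_split_epi f r k) (hq : schreier_retraction f r k q)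
    (h : {conjmon X -> B}) :
  induces_internal_groupoid f r k h <->
  [/\ forall (x : X) (b : B), h (schreier_action r k q b x) + b = b + h x,
      forall x y : X, schreier_action r k q (h y) x + y = y + x
    & exists opp : X -> X,
        group_inversion opp /\ forall x : X, opp (conjm x) = conjm (opp x)].
Proof.
split=> [[c [ck cr [_ [m [hm [t ht]]]]]]|[C1 C2 [opp [hopp _]]]].
  split=> [x b|x y|].
  - by rewrite -!ck (codomain_action hfr hq cr).
  - by rewrite -ck (composition_interchange hfr hq hm).
  - have hopp := left_inverse_group (inverse_left_inverse hfr hq hm ht).
    by exists (fun x => q (t (k x))); split=> //; apply: group_inversion_conj.
have [c cE] := codomain_exists hfr hq C1.
have [m mE] := composition_exists hfr hq C2 cE.
have [t ht] := inverse_exists hfr hq cE mE hopp.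
exists c; split=> [x|b|].
- exact: (codomain_ker hfr hq cE).
- exact: (codomain_section hfr hq cE).
split.
  by split; [exact: (splitK hfr) | exact: (codomain_section hfr hq cE)].
exists m; split; first exact: (composition_internal hfr hq cE mE).
by exists t.
Qed.
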